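(* Let $A_F$ be a nonzero right vector space over a division ring $F$ and let $S={\rm End}(A_F)$. The following conditions are equivalent: (i) $(S,\mathcal T_{fin})$ is a completely simple topological ring; (ii) either $\dim(A_F)=\infty$, or $\dim(A_F)<\infty$ and $F$ does not admit a nondiscrete ring topology.
   Context: ${\rm End}(A_F)$ is the ring of all $F$-linear endomorphisms of $A$. The finite topology $\mathcal T_{fin}$ on it is the ring topology for which the sets $T(K)=\{\alpha\in S : \alpha(K)=0\}$, $K$ ranging over all finite subsets of $A$, form a fundamental system of neighborhoods of zero. A ring topology is a topology for which addition, negation and multiplication are (jointly) continuous; all topologies considered are assumed completely regular, in particular Hausdorff. A topological ring $(R,\mathcal T)$ is completely simple if $R^2\neq 0$ and for every continuous ring homomorphism $f:(R,\mathcal T)\to (S',\mathcal U)$ into a (Hausdorff) topological ring $(S',\mathcal U)$, either $\ker(f)=R$ or $f$ is a homeomorphism of $(R,\mathcal T)$ onto ${\rm Im}(f)$ with the subspace topology. *)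

(* Defs.v *)
From HB Require Import structures.
From mathcomp Require Import all_boot all_algebra.
From mathcomp Require Import all_classical all_reals topology normedtype.

Set Implicit Arguments.
Unset Strict Implicit.
Unset Printing Implicit Defensive.

Import GRing.Theory.
Local Open Scope classical_set_scope.
Local Open Scope ring_scope.

(* Rings are associative but need not have an identity, and their morphisms
   are not required to preserve one. *)
Record rng := Rng {
  rng_zmod :> zmodType;
  rng_mul : rng_zmod -> rng_zmod -> rng_zmod;
  rng_mulA : associative rng_mul;
  rng_mulDl : left_distributive rng_mul +%R;
  rng_mulDr : right_distributive rng_mul +%R }.

Definition rng_of_ring (R : pzRingType) : rng :=
  Rng (@mulrA R) (@mulrDl R) (@mulrDr R).

(* Topological X is the type of topologies on the carrier X, and
   Topological.Pack tau is X equipped with tau.  The predicate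
   completely_regular_space does not include separation of points, hence the
   additional Hausdorff clause. *)
Definition ring_topology (R : rng) (tau : Topological R) : Prop :=
  let X : topologicalType := Topological.Pack tau in
  [/\ continuous (fun p : X * X => (p.1 : R) + (p.2 : R) : X),
      continuous (fun x : X => - (x : R) : X),
      continuous (fun p : X * X => rng_mul (p.1 : R) (p.2 : R) : X),
      hausdorff_space X & completely_regular_space X].

Definition discrete (X : topologicalType) : Prop := forall U : set X, open U.

Definition homeomorphism_onto_image (X Y : topologicalType) (f : X -> Y) :
    Prop :=
  continuous f /\
  exists g : Y -> X, cancel f g /\ {within range f, continuous g}.

Definition completely_simple (R : rng) (tau : Topological R) : Prop :=
  [/\ ring_topology tau,
      ~ (forall x y : R, rng_mul x y = 0) &
      forall (S : rng) (sigma : Topological S), ring_topology sigma ->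
      forall f : {additive R -> S},
        {morph f : x y / rng_mul x y >-> rng_mul x y} ->
        continuous (f : Topological.Pack tau -> Topological.Pack sigma) ->
        (forall x, f x = 0) \/
        homeomorphism_onto_image
          (f : Topological.Pack tau -> Topological.Pack sigma)].

Definition is_basis (K : pzRingType) (V : lmodType K) (n : nat)
    (e : 'I_n -> V) : Prop :=
  (forall c : 'I_n -> K, \sum_i c i *: e i = 0 -> forall i, c i = 0) /\
  (forall v, exists c : 'I_n -> K, v = \sum_i c i *: e i).

Definition finite_dimensional (K : pzRingType) (V : lmodType K) : Prop :=
  exists (n : nat) (e : 'I_n -> V), is_basis e.

Section EndomorphismRing.
Context (K : pzRingType) (V : lmodType K).
Local Notation E := {linear V -> V}.
Implicit Types f g h : E.

Lemma lin_ext f g : f =1 g -> f = g.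
Proof.
move=> fg; have {fg} : f = g :> (V -> V) by exact/funext.
case: f g => [f [[fa] [fl]]] [g [[ga] [gl]]] /= fg; subst g.
by rewrite (Prop_irrelevance fl gl); case: fa ga => [p q] [p' q'];
  rewrite (Prop_irrelevance p p') (Prop_irrelevance q q').
Qed.

Definition lin_zero : E := \0.
Definition lin_opp f : E := \- f.
Definition lin_add f g : E := f \+ g.
Definition lin_one : E := idfun.
Definition lin_mul f g : E := f \o g.

Fact lin_addA : associative lin_add.
Proof. by move=> f g h; apply: lin_ext => v /=; rewrite addrA. Qed.
Fact lin_addC : commutative lin_add.
Proof. by move=> f g; apply: lin_ext => v /=; rewrite addrC. Qed.
Fact lin_add0 : left_id lin_zero lin_add.
Proof. by move=> f; apply: lin_ext => v /=; rewrite add0r. Qed.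
Fact lin_addN : left_inverse lin_zero lin_opp lin_add.
Proof. by move=> f; apply: lin_ext => v /=; rewrite addNr. Qed.

HB.instance Definition _ := GRing.isZmodule.Build E
  lin_addA lin_addC lin_add0 lin_addN.

Fact lin_mulA : associative lin_mul.
Proof. by move=> f g h; apply: lin_ext. Qed.
Fact lin_mul1l : left_id lin_one lin_mul.
Proof. by move=> f; apply: lin_ext. Qed.
Fact lin_mul1r : right_id lin_one lin_mul.
Proof. by move=> f; apply: lin_ext. Qed.
Fact lin_mulDl : left_distributive lin_mul +%R.
Proof. by move=> f g h; apply: lin_ext. Qed.
Fact lin_mulDr : right_distributive lin_mul +%R.
Proof. by move=> f g h; apply: lin_ext => v; apply: linearD. Qed.

HB.instance Definition _ := GRing.Zmodule_isPzRing.Build E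
  lin_mulA lin_mul1l lin_mul1r lin_mulDl lin_mulDr.

Definition annihilator (X : set V) : set E :=
  [set f | forall v, X v -> f v = 0].

Definition finite_nbhs f : set_system E :=
  filter_from finite_set (fun X => [set g | annihilator X (g - f)]).

End EndomorphismRing.

Definition with_finite_topology (K : pzRingType) (V : lmodType K) : Type :=
  {linear V -> V}.

Section FiniteTopology.
Context (K : pzRingType) (V : lmodType K).
Local Notation E := (with_finite_topology V).

HB.instance Definition _ := Choice.copy E {linear V -> V}.
HB.instance Definition _ := hasNbhs.Build E (@finite_nbhs K V).

Let finite_nbhs_self (X : set V) (f : {linear V -> V}) : annihilator X (f - f).
Proof. by move=> v _; rewrite subrr. Qed.

Fact finite_nbhs_filter (f : E) : ProperFilter (nbhs f).
Proof.
apply: filter_from_proper; last by move=> X _; exists f; apply: finite_nbhs_self.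
apply: filter_from_filter; first by exists set0.
move=> X Y finX finY; exists (X `|` Y); first by rewrite finite_setU.
by move=> g gXY; split=> v Zv; apply: gXY; [left | right].
Qed.

Fact finite_nbhs_singleton (f : E) (A : set E) : nbhs f A -> A f.
Proof. by move=> [X _]; apply; apply: finite_nbhs_self. Qed.

Fact finite_nbhs_nbhs (f : E) (A : set E) : nbhs f A -> nbhs f (nbhs^~ A).
Proof.
move=> [X finX XA]; exists X => // g gX; exists X => // h hX; apply: XA => v Xv.
have -> : (h : {linear V -> V}) - (f : {linear V -> V}) =
    ((h : {linear V -> V}) - (g : {linear V -> V})) +
    ((g : {linear V -> V}) - (f : {linear V -> V})) by rewrite subrKA.
by have /= := hX v Xv; have /= := gX v Xv => e1 e2;
  rewrite -[LHS]/(_ + _) e1 e2 addr0.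
Qed.

HB.instance Definition _ := Nbhs_isNbhsTopological.Build E
  finite_nbhs_filter finite_nbhs_singleton finite_nbhs_nbhs.

End FiniteTopology.

Definition finite_topology (K : pzRingType) (V : lmodType K) :
    Topological {linear V -> V} :=
  Topological.class (with_finite_topology V).

(* Main.v *)
Require Import Defs.
From HB Require Import structures.
From mathcomp Require Import all_boot all_algebra.
From mathcomp Require Import all_classical all_reals topology normedtype.

(** Write S for the endomorphism ring of A with the finite topology, and
    rank_one u phi for the operator sending v to u scaled by phi v.

    Finite dimension, F carrying a nondiscrete ring topology tau.  Then S is
    discrete, while tau induces on S the topology of convergence of all matrix
    entries.  This is a ring topology, and it is not discrete because F embeds
    continuously in S as a line of rank-one operators.  The identity map from S
    to this coarser topology is continuous and injective but not a
    homeomorphism, so S is not completely simple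
    (discrete_of_completely_simple).

    Conversely, let f be a nonzero continuous homomorphism from S to a
    Hausdorff topological ring S'.  A rank-one operator generates all the
    others by products and the finite-rank operators are dense in S, so f does
    not kill rank_one x phi when phi x = 1 (image_rank_one_neq0).  It is then
    enough to find, for each vector x, a neighbourhood W of 0 in S' such that
    f a in W forces a x = 0 (homeomorphism_of_nbhs): injectivity and openness
    both follow.

    - Finite dimension: pulling the topology of S' back along the embedding of
      F as a line of rank-one operators gives a ring topology on F, which is
      discrete by assumption.  Multiplying a on both sides by rank-one
      operators moves the coordinates of a x into that line, so they vanish as
      soon as f a is close to 0 (discrete_line, nbhs_of_discrete_line).

    - Infinite dimension: put e = rank_one x phi with phi x = 1, choose a
      neighbourhood U of 0 without f e, and W with W.W inside U.  By continuity
      W contains the image of every operator vanishing on some finite set, and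
      hence of every operator vanishing on a suitable finite-dimensional
      subspace M.  If f (t a e) is in W, then t a x is in M: otherwise an
      operator b vanishing on M brings t a x back to x, and e = b (t a e) has
      its image in W.W.  Taking the identity for t shows that a x is in M;
      taking for t the coordinate functionals of M followed by the embedding of
      a line outside M shows that the coordinates of a x vanish
      (nbhs_of_infinite_dimensional).

    The linear algebra behind both cases is the existence of functionals that
    separate a vector from a subspace, by Zorn's lemma.  Complete regularity of
    each ring topology that is constructed comes from the translation
    uniformity of its additive group. *)

Set Implicit Arguments.
Unset Strict Implicit.
Unset Printing Implicit Defensive.

Import GRing.Theory.
Local Open Scope classical_set_scope.
Local Open Scope ring_scope.

(** * Functionals on a vector space over a division ring *)

Section Subspaces.
Variables (K : unitRingType) (V : lmodType K).

Definition subspace_of (M : set V) : Prop :=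
  M 0 /\ forall c u v, M u -> M v -> M (c *: u + v).

Lemma subspace_ofZ M c u : subspace_of M -> M u -> M (c *: u).
Proof. by move=> [M0 ML] Mu; rewrite -[_ *: _]addr0; apply: ML. Qed.

Lemma subspace_ofD M u v : subspace_of M -> M u -> M v -> M (u + v).
Proof. by move=> [M0 ML] Mu; rewrite -[u]scale1r; apply: ML. Qed.

Lemma subspace_ofB M u v : subspace_of M -> M u -> M v -> M (u - v).
Proof.
by move=> Ms Mu Mv; rewrite -scaleN1r addrC; case: Ms => _; apply.
Qed.

Lemma subspace_of0 : subspace_of [set 0].
Proof. by split => // c u v -> ->; rewrite scaler0 addr0. Qed.

Lemma subspace_of_adjoin M w : subspace_of M ->
  subspace_of [set u | exists c, M (u - c *: w)].
Proof.
move=> Ms; split; first by exists 0; rewrite scale0r subrr; case: Ms.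
move=> c u v [a Ma] [b Mb]; exists (c * a + b).
rewrite scalerDl -scalerA opprD addrACA -scalerBr.
by case: Ms => _; apply.
Qed.

Lemma subspace_reconstructed n (e : 'I_n -> V)
    (phi : 'I_n -> {linear V -> K^o}) :
  subspace_of [set v | v = \sum_i (phi i v : K) *: e i].
Proof.
split; first by rewrite /= big1// => i _; rewrite linear0 scale0r.
move=> c u v /= Mu Mv; rewrite [in LHS]Mu [in LHS]Mv scaler_sumr.
rewrite -big_split/=; apply: eq_bigr => i _.
by rewrite linearD linearZ/= scalerDl scalerA.
Qed.

End Subspaces.

Section Functionals.
Variables (K : unitRingType) (V : lmodType K).
Hypothesis K_division : forall x : K, x != 0 -> x \is a GRing.unit.

(** A subspace maximal among those that contain M and miss v is a complement
    of the line of v. *)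
Lemma maximal_subspace_avoiding (M : set V) v : subspace_of M -> ~ M v ->
  exists H, [/\ subspace_of H, M `<=` H, ~ H v &
    forall w, exists c, H (w - c *: v)].
Proof.
move=> Ms Mv.
(* Joining M to each member makes the empty chain harmless. *)
pose P N := subspace_of (M `|` N) /\ ~ (M `|` N) v.
have [C CP totC|N [[Hs Hv] maxN]] := @Zorn_bigcup V P.
  split; last first.
    by case=> // -[N CN Nv]; have [_] := CP _ CN; apply; right.
  split; first by left; case: Ms.
  move=> c x y.
  have inU N z : C N -> (M `|` N) z -> (M `|` \bigcup_(X in C) X) z.
    by move=> CN [Mz|Nz]; [left|right; exists N].
  case=> [Mx|[N CN Nx]].
    case=> [My|[N CN Ny]]; first by left; case: Ms => _; apply.
    have [[_ L] _] := CP _ CN.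
    by apply: (inU _ _ CN); apply: L; [left|right].
  case=> [My|[N' CN' Ny]].
    have [[_ L] _] := CP _ CN.
    by apply: (inU _ _ CN); apply: L; [right|left].
  have [NN'|N'N] := totC _ _ CN CN'.
    have [[_ L] _] := CP _ CN'.
    by apply: (inU _ _ CN'); apply: L; right => //; apply: NN'.
  have [[_ L] _] := CP _ CN.
  by apply: (inU _ _ CN); apply: L; right => //; apply: N'N.
exists (M `|` N); split => //.
move=> w; have [Hw|Hw] := pselect ((M `|` N) w).
  by exists 0; rewrite scale0r subr0.
pose N' := [set u | exists c, (M `|` N) (u - c *: w)].
have sub : M `|` N `<=` N' by move=> u Hu; exists 0; rewrite scale0r subr0.
have NN' : N `<` N'.
  split; first by move=> u Nu; apply: sub; right.
  move=> /(_ w) N'w; apply: Hw; right; apply: N'w; exists 1.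
  by rewrite scale1r subrr; case: Hs.
have := maxN _ NN'; rewrite /P.
have -> : M `|` N' = N' by apply/setUidPr => u Mu; apply: sub; left.
move=> nP; have {nP} : N' v.
  by apply: contrapT => nN'v; apply: nP; split => //;
     apply: subspace_of_adjoin.
move=> [c Hc].
have c0 : c != 0.
  by apply/eqP => c0; move: Hc; rewrite c0 scale0r subr0.
exists c^-1; have -> : w - c^-1 *: v = - c^-1 *: (v - c *: w).
  by rewrite scalerBr scaleNr scalerA mulNr mulVr ?K_division// scaleN1r opprK
    addrC.
exact: subspace_ofZ.
Qed.

Lemma separating_functional (M : set V) v : subspace_of M -> ~ M v ->
  exists phi : {linear V -> K^o}, (forall u, M u -> phi u = 0) /\ phi v = 1.
Proof.
move=> Ms Mv.
have [H [Hs MH Hv coord]] := maximal_subspace_avoiding Ms Mv.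
have [phi phiP] := choice coord.
have uniq w c : H (w - c *: v) -> phi w = c.
  move=> Hc; apply/eqP; rewrite -subr_eq0; apply/negP => /negP d0.
  apply: Hv; have := subspace_ofB Hs Hc (phiP w).
  rewrite opprB addrC addrA subrK -scalerBl.
  by move=> /(subspace_ofZ (phi w - c)^-1 Hs);
     rewrite scalerA mulVr ?K_division// scale1r.
have phi_linear : linear (phi : V -> K^o).
  move=> a u w; apply: uniq; rewrite scalerDl -scalerA opprD addrACA -scalerBr.
  by case: Hs => _; apply.
pose phiL : {linear V -> K^o} :=
  HB.pack (phi : V -> K^o) (GRing.isLinear.Build K V K^o *:%R phi phi_linear).
exists phiL; split; last by apply: uniq; rewrite scale1r subrr; case: Hs.
by move=> u Mu; apply: uniq; rewrite scale0r subr0; apply: MH.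
Qed.

Lemma normalizing_functional (v : V) : v != 0 ->
  exists phi : {linear V -> K^o}, phi v = 1.
Proof.
move=> /eqP v0.
by have [phi [_ phiv]] := separating_functional (@subspace_of0 _ V) v0;
  exists phi.
Qed.

(** Every finite list lies in a subspace with a basis whose dual basis extends
    to the whole space: a new vector x is replaced by its defect y with
    respect to the coordinates already found, which those coordinates kill. *)
Lemma coordinate_system (X : seq V) :
  exists n (e : 'I_n -> V) (phi : 'I_n -> {linear V -> K^o}),
    (forall i j, phi i (e j) = (i == j)%:R) /\
    (forall x, x \in X -> x = \sum_i phi i x *: e i).
Proof.
elim: X => [|x X [n [e [phi [dual repr]]]]].
  by exists 0%N, (fun=> 0), (fun=> \0); split=> // -[].
pose M := [set v | v = \sum_i phi i v *: e i].
have Ms : subspace_of M by exact: subspace_reconstructed.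
have Me i : M (e i).
  rewrite /M/= (bigD1 i)//= dual eqxx scale1r big1 ?addr0// => j ji.
  by rewrite dual (negPf ji) scale0r.
have [Mx|Mx] := pselect (M x).
  exists n, e, phi; split=> // y; rewrite inE => /predU1P[->//|]; exact: repr.
have [psi [psiM psix]] := separating_functional Ms Mx.
pose y := x - \sum_i phi i x *: e i.
have phiy j : phi j y = 0.
  rewrite linearB linear_sum (bigD1 j)//= linearZ/= dual eqxx big1 => [|i ij].
    by rewrite addr0 /GRing.scale/= mulr1 subrr.
  by rewrite linearZ/= dual eq_sym (negPf ij) scaler0.
have psie j : psi (e j) = 0 by exact: psiM.
have psiy : psi y = 1.
  rewrite linearB linear_sum big1 ?subr0// => i _.
  by rewrite linearZ/= psie scaler0.
exists n.+1, (fun i => oapp e y (unlift ord0 i)),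
  (fun i => oapp phi psi (unlift ord0 i)); split.
  move=> i j; case: (unliftP ord0 i) => [i'|] ->;
  by case: (unliftP ord0 j) => [j'|] ->; rewrite ?liftK ?unlift_none//=.
move=> z; rewrite big_ord_recl unlift_none/= inE => zX.
under eq_bigr do rewrite liftK/=.
case/predU1P: zX => [->|/repr zM]; last by rewrite psiM// scale0r add0r.
by rewrite psix scale1r subrK.
Qed.

Lemma basis_coordinates : finite_dimensional V ->
  exists n (e : 'I_n -> V) (phi : 'I_n -> {linear V -> K^o}),
    forall v, v = \sum_i (phi i v : K) *: e i.
Proof.
move=> [m [b [_ span]]].
have [n [e [phi [_ repr]]]] := coordinate_system (codom b).
exists n, e, phi => v; have [c ->] := span v.
have Ms := subspace_reconstructed e phi.
apply: (big_ind [set v | v = \sum_i (phi i v : K) *: e i]).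
- by case: Ms.
- by move=> *; exact: (subspace_ofD Ms).
- by move=> i _; apply: (subspace_ofZ _ Ms); apply: repr; exact: codom_f.
Qed.

End Functionals.

Section RankOne.
Variables (K : unitRingType) (V : lmodType K).
Local Notation E := {linear V -> V}.

Fact rank_one_subproof (u : V) (phi : {linear V -> K^o}) :
  linear (fun v => (phi v : K) *: u).
Proof. by move=> c v w; rewrite linearP scalerDl scalerA. Qed.

Definition rank_one (u : V) (phi : {linear V -> K^o}) : E :=
  HB.pack (fun v => (phi v : K) *: u)
    (GRing.isLinear.Build K V V *:%R _ (rank_one_subproof u phi)).

Lemma rank_oneE u phi v : rank_one u phi v = (phi v : K) *: u.
Proof. by []. Qed.

Lemma rank_oneDl u v phi :
  rank_one (u + v) phi = rank_one u phi + rank_one v phi.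
Proof. by apply: lin_ext => w; rewrite rank_oneE scalerDr. Qed.

End RankOne.

(** * Topological groups and rings *)

Lemma continuous_op2 (T X Y Z : topologicalType) (op : X * Y -> Z)
    (f : T -> X) (g : T -> Y) :
  continuous op -> continuous f -> continuous g ->
  continuous (fun t => op (f t, g t)).
Proof.
move=> cop cf cg t.
apply: (@continuous_comp T (X * Y)%type Z (fun t => (f t, g t)) op).
  by apply: cvg_pair; [apply: cf | apply: cg].
exact: cop.
Qed.

Lemma continuous_op2_pair (T T' X Y Z : topologicalType) (op : X * Y -> Z)
    (f : T -> X) (g : T' -> Y) :
  continuous op -> continuous f -> continuous g ->
  continuous (fun p : T * T' => op (f p.1, g p.2)).
Proof.
move=> cop cf cg.
apply: (@continuous_op2 _ X Y Z op (f \o fst) (g \o snd)) => // p.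
- by apply: continuous_comp; [exact: cvg_fst|exact: cf].
- by apply: continuous_comp; [exact: cvg_snd|exact: cg].
Qed.

Section TopologicalGroup.
Variables (G : zmodType) (tau : Topological G).
Local Notation X := (Topological.Pack tau).
Hypothesis addc : continuous (fun p : X * X => (p.1 : G) + (p.2 : G) : X).

Lemma nbhs_shift (a b : G) (U : set G) :
  nbhs (b + a : X) U -> nbhs (b : X) [set x : X | U ((x : G) + a)].
Proof.
have shift : continuous (fun x : X => (x : G) + a : X).
  apply: (@continuous_op2 X X X X
    (fun p : X * X => (p.1 : G) + (p.2 : G) : X) id (fun=> a : X)) => //.
    by move=> t; apply: cvg_id.
  by move=> t; apply: cvg_cst.
exact: shift.
Qed.

Lemma discrete_of_nbhs0 : nbhs (0 : X) [set 0] -> discrete X.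
Proof.
move=> nbhs0 U; rewrite (@openE X) => a Ua.
have nbhs_a : nbhs (a : X) [set y : G | y - a = 0].
  by apply: (@nbhs_shift (- a) a [set 0]); rewrite subrr.
apply: (@filterS X _ (nbhs_filter _) _ _ _ nbhs_a) => y.
by move=> /eqP; rewrite subr_eq0 => /eqP ->.
Qed.

Lemma nbhs0_half (U : set G) : nbhs (0 : X) U ->
  exists2 W : set G, nbhs (0 : X) W & forall x y : G, W x -> W y -> U (x + y).
Proof.
move=> U0.
have /(_ U) := @addc ((0 : G) : X, (0 : G) : X).
rewrite /= addr0 => /(_ U0)[[P Q]/= [P0 Q0] PQ].
exists (P `&` Q); first exact: filterI.
by move=> x y [Px _] [_ Qy]; apply: (PQ (x, y)).
Qed.

Hypothesis oppc : continuous (fun x : X => - (x : G) : X).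

(** The differences that lie in a neighbourhood of 0 form a uniformity that
    induces the topology. *)
Lemma group_completely_regular : completely_regular_space X.
Proof.
pose ent := filter_from (nbhs (0 : X))
  (fun U => [set p : G * G | U (p.2 - p.1)]).
have ent_filter : Filter ent.
  apply: filter_from_filter; first by exists setT; apply: filterT.
  by move=> U W U0 W0; exists (U `&` W) => //; apply: filterI.
have ent_diag N : ent N -> diagonal `<=` N.
  move=> [U U0 UN] [x y] /= xy; apply: UN => /=.
  by rewrite -(xy : x = y) subrr; exact: (nbhs_singleton U0).
have ent_inv N : ent N -> ent (N^-1)%relation.
  move=> [U U0 UN]; exists [set x : G | U (- x)].
    by apply: (@oppc (0 : G)); rewrite /= oppr0.
  by move=> [x y] /= Uxy; apply: UN; rewrite /= -opprB.
have ent_split N : ent N -> exists2 B, ent B & (B \; B `<=` N)%relation.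
  move=> [U U0 UN]; have [W W0 WU] := nbhs0_half U0.
  exists [set p : G * G | W (p.2 - p.1)]; first by exists W.
  move=> [x y] /= [z Wxz Wzy]; apply: UN => /=.
  by have := WU _ _ Wzy Wxz; rewrite /= subrKA.
pose unif : uniformType :=
  HB.pack G (@isUniform.Build G ent ent_filter ent_diag ent_inv ent_split).
move=> a B Bcl Ba.
have aB : nbhs (0 + a : X) (~` B).
  by rewrite add0r; apply: open_nbhs_nbhs; split => //; exact: closed_openC.
exists (Uniform.class unif), [set p : G * G | ~ B ((p.2 - p.1) + (a : G))].
split.
- by exists [set x : G | ~ B (x + a)] => //; exact: nbhs_shift aB.
- rewrite -subset0 => -[x y] /= [[-> By]]; apply; by rewrite subrK.
- move=> x N; rewrite -nbhs_entourageE => -[D [U U0 UD] DN].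
  have : nbhs (x : X) [set y : G | U (y - x)].
    by apply: nbhs_shift; rewrite subrr.
  by apply: filterS => y Uxy; apply: DN; apply/xsectionP; apply: UD.
Qed.

End TopologicalGroup.

Lemma continuous_big_add (G : zmodType) (tau : Topological G)
    (X := Topological.Pack tau) (T : topologicalType) n (g : 'I_n -> T -> X) :
  continuous (fun p : X * X => (p.1 : G) + (p.2 : G) : X) ->
  (forall i, continuous (g i)) ->
  continuous (fun t => \sum_i (g i t : G) : X).
Proof.
move=> addc; elim: n g => [|n IHn] g gc.
  under eq_fun do rewrite big_ord0; by move=> t; apply: cvg_cst.
under eq_fun do rewrite big_ord_recl.
apply: (@continuous_op2 _ X X X
  (fun p : X * X => (p.1 : G) + (p.2 : G) : X)) => //.
by apply: IHn => i.
Qed.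

Section TopologicalRing.
Variables (R : rng) (tau : Topological R).
Local Notation X := (Topological.Pack tau).
Hypothesis tau_ring : ring_topology tau.

Lemma rng_mul0 (x : R) : rng_mul x 0 = 0.
Proof. by apply: (addrI (rng_mul x 0)); rewrite -rng_mulDr !addr0. Qed.

Lemma rng_0mul (x : R) : rng_mul 0 x = 0.
Proof. by apply: (addrI (rng_mul 0 x)); rewrite -rng_mulDl !addr0. Qed.

Lemma nbhs0_avoiding (y : R) : y <> 0 -> exists2 U, nbhs (0 : X) U & ~ U y.
Proof.
move=> y0; apply: contrapT => noU; apply: y0; apply/esym.
case: tau_ring => _ _ _ haus _; apply: haus => U W U0 Wy; exists y.
split; last exact: nbhs_singleton Wy.
by apply: contrapT => Uy; apply: noU; exists U.
Qed.

Lemma nbhs0_mul (U : set R) : nbhs (0 : X) U ->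
  exists2 W : set R, nbhs (0 : X) W &
    forall x y : R, W x -> W y -> U (rng_mul x y).
Proof.
move=> U0; case: tau_ring => _ _ mulc _ _.
have /(_ U) := @mulc ((0 : R) : X, (0 : R) : X).
rewrite /= rng_mul0 => /(_ U0)[[P Q]/= [P0 Q0] PQ].
exists (P `&` Q); first exact: filterI.
by move=> x y [Px _] [_ Qy]; apply: (PQ (x, y)).
Qed.

Lemma nbhs0_mulLR (a b : R) (U : set R) : nbhs (0 : X) U ->
  nbhs (0 : X) [set y : R | U (rng_mul (rng_mul a y) b)].
Proof.
move=> U0; case: tau_ring => _ _ mulc _ _.
have c : continuous (fun y : X => rng_mul (rng_mul a y) b : X).
  apply: (@continuous_op2 X X X X
    (fun p : X * X => rng_mul (p.1 : R) (p.2 : R) : X)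
    (fun y => rng_mul a y) (fun=> b)) => //; last by move=> y; apply: cvg_cst.
  apply: (@continuous_op2 X X X X
    (fun p : X * X => rng_mul (p.1 : R) (p.2 : R) : X)
    (fun=> a) id) => //; first by move=> y; apply: cvg_cst.
  by move=> y; apply: cvg_id.
by apply: (@c (0 : R)); rewrite /= rng_mul0 rng_0mul.
Qed.

End TopologicalRing.

Section InitialTopology.
Variables (R S : rng) (sigma : Topological S).
Variables (I : Type) (h : I -> R -> S).
Local Notation Y := (Topological.Pack sigma).

Definition initial_of_family : Topological R :=
  Topological.class
    (sup_topology (fun i => Topological.class
       (initial_topology (h i : R -> Y)))).
Local Notation X := (Topological.Pack initial_of_family).

Lemma continuous_of_initial i : continuous (h i : X -> Y).
Proof.
move=> x.
apply: (@cvg_trans _ (h i @ nbhs (x : initial_topology (h i : R -> Y)))).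
  apply: cvg_app.
  have := @cvg_sup R I (fun i => Topological.class
       (initial_topology (h i : R -> Y))) (nbhs (x : X)) x _.
  by move=> [+ _]; apply; apply: cvg_id.
exact: (@initial_continuous R Y (h i) x).
Qed.

Lemma continuous_to_initial (T : topologicalType) (f : T -> X) :
  (forall i, continuous (h i \o f : T -> Y)) -> continuous f.
Proof.
move=> cf x; apply/cvg_sup => i.
by apply: (@continuous_comp_initial _ T Y (h i : R -> Y) f).
Qed.

Lemma nbhs_initial_constant (h0 : R -> S) :
  (forall i, h i = h0) -> forall (x : R) (U : set R), nbhs (x : X) U ->
  exists2 N : set S, nbhs (h0 x : Y) N & h0 @^-1` N `<=` U.
Proof.
move=> hE x U xU.
pose P := filter_from (nbhs (h0 x : Y)) (fun N => h0 @^-1` N).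
have PF : Filter P.
  apply: filter_from_filter; first by exists setT; exact: filterT.
  by move=> N N' xN xN'; exists (N `&` N') => //; exact: filterI.
suff : P --> (x : X) by move/(_ U xU).
apply/cvg_sup => i V [_ [[W oW <-] Wx WV]]; exists W => //.
  by rewrite -(hE i); exact: open_nbhs_nbhs.
by rewrite -(hE i).
Qed.

Hypothesis hD : forall i, {morph h i : x y / x + y}.
Hypothesis h_inj : forall x y, (forall i, h i x = h i y) -> x = y.
Hypothesis sigma_ring : ring_topology sigma.
Hypothesis hM : forall i,
  continuous (fun p : X * X => h i (rng_mul (p.1 : R) (p.2 : R)) : Y).

(** The maps h i are only assumed additive, so that the entries of a matrix
    are covered as well as a ring homomorphism. *)
Lemma initial_ring_topology : ring_topology initial_of_family.
Proof.
case: sigma_ring => addc oppc mulc haus _.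
have h0 i : h i 0 = 0.
  by apply: (addrI (h i 0)); rewrite -hD !addr0.
have hN i x : h i (- x) = - h i x.
  by apply: (addrI (h i x)); rewrite -hD !subrr h0.
have caddX : continuous (fun p : X * X => (p.1 : R) + (p.2 : R) : X).
  apply: continuous_to_initial => i.
  rewrite (_ : _ \o _ =
      fun p : X * X => (h i p.1 : S) + (h i p.2 : S) : Y).
    apply: (@continuous_op2_pair X X Y Y Y
      (fun p : Y * Y => (p.1 : S) + (p.2 : S) : Y) (h i) (h i)) => //;
      exact: continuous_of_initial.
  by apply/funext => p /=; rewrite hD.
have coppX : continuous (fun x : X => - (x : R) : X).
  apply: continuous_to_initial => i.
  rewrite (_ : _ \o _ = fun x : X => - (h i x : S) : Y).
    move=> x; apply: (@continuous_comp X Y Y).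
      exact: continuous_of_initial.
    exact: oppc.
  by apply/funext => x /=; rewrite hN.
split=> //.
- exact: continuous_to_initial.
- move=> x y xy; apply: h_inj => i; apply: haus => A B Ax By.
  have [z [Az Bz]] :=
    xy _ _ (continuous_of_initial Ax) (continuous_of_initial By).
  by exists (h i z).
- exact: group_completely_regular.
Qed.

End InitialTopology.

Section FiniteTopology.
Variables (K : pzRingType) (V : lmodType K).
Local Notation E := {linear V -> V}.
Local Notation X := (Topological.Pack (finite_topology V)).

Lemma finite_ring_topology :
  @ring_topology (rng_of_ring E) (finite_topology V).
Proof.
have addc : continuous (fun p : X * X => (p.1 : E) + (p.2 : E) : X).
  move=> [f g] U [Z finZ ZU].
  exists ([set f' : E | annihilator Z (f' - f)],
          [set g' : E | annihilator Z (g' - g)]).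
    by split; exists Z.
  move=> [f' g'] /= [f'Z g'Z]; apply: ZU => v Zv.
  have := f'Z v Zv; have := g'Z v Zv; rewrite /= => e1 e2.
  by rewrite -[LHS]/((f' v + g' v) - (f v + g v)) opprD addrACA e1 e2 addr0.
have oppc : continuous (fun f : X => - (f : E) : X).
  move=> f U [Z finZ ZU]; exists Z => // f' f'Z; apply: ZU => v Zv.
  have := f'Z v Zv; rewrite /= => e1.
  by rewrite -[LHS]/(- f' v - - f v) -opprD e1 oppr0.
split=> //; last exact: group_completely_regular.
- move=> [f g] U [Z finZ ZU].
  exists ([set f' : E | annihilator ((g : E) @` Z) (f' - f)],
          [set g' : E | annihilator Z (g' - g)]).
    split; last by exists Z.
    by exists ((g : E) @` Z) => //; exact: finite_image.
  move=> [f' g'] /= [f'Z g'Z]; apply: ZU => v Zv.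
  have /= /eqP := f'Z (g v) (imageP _ Zv); rewrite subr_eq0 => /eqP e1.
  have /= /eqP := g'Z v Zv; rewrite subr_eq0 => /eqP e2.
  by rewrite -[LHS]/(f' (g' v) - f (g v)) e2 e1 subrr.
- move=> f g fg; apply: lin_ext => v.
  have [||h [hf hg]] := fg [set h : E | annihilator [set v] (h - f)]
                           [set h : E | annihilator [set v] (h - g)].
  + by exists [set v].
  + by exists [set v].
  have /= /eqP := hf v erefl; rewrite subr_eq0 => /eqP <-.
  by have /= /eqP := hg v erefl; rewrite subr_eq0 => /eqP <-.
Qed.

Lemma finite_topology_discrete : finite_dimensional V -> discrete X.
Proof.
move=> [n [e [_ span]]]; have [addc _ _ _ _] := finite_ring_topology.
apply: (discrete_of_nbhs0 addc); exists (range e); first exact: finite_image.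
move=> a ae; apply: lin_ext => v; have [c ->] := span v.
rewrite linear_sum big1// => i _; rewrite linearZ/= -[a _]subr0.
have -> : a (e i) - 0 = 0 by apply: (ae (e i)); exact: imageP.
by rewrite scaler0.
Qed.

End FiniteTopology.

(** * Continuous homomorphisms from an endomorphism ring *)

Section Homomorphism.
Variables (K : unitRingType) (V : lmodType K).
Hypothesis K_division : forall x : K, x != 0 -> x \is a GRing.unit.
Local Notation E := {linear V -> V}.
Local Notation X := (Topological.Pack (finite_topology V)).
Variables (S : rng) (sigma : Topological S).
Local Notation Y := (Topological.Pack sigma).
Hypothesis sigma_ring : ring_topology sigma.
Variable f : {additive rng_of_ring E -> S}.
Hypothesis f_cont : continuous (f : X -> Y).

Lemma homeomorphism_of_nbhs :
  (forall x : V, exists2 W : set S, nbhs (0 : Y) W &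
     forall a : E, W (f a) -> a x = 0) ->
  homeomorphism_onto_image (f : X -> Y).
Proof.
move=> nbhsW; split=> //.
have f_inj : injective f.
  move=> a b ab; apply: lin_ext => v; apply/eqP; rewrite -subr_eq0.
  have [W W0 WP] := nbhsW v; rewrite -[_ - _]/((a - b : E) v) WP //.
  by rewrite raddfB ab subrr; exact: (nbhs_singleton W0).
have nbhs_seq (s : seq V) : exists2 W : set S, nbhs (0 : Y) W &
    forall a : E, W (f a) -> forall v, v \in s -> a v = 0.
  elim: s => [|v s [W W0 WP]]; first by exists setT => //; exact: filterT.
  have [W' W'0 W'P] := nbhsW v; exists (W' `&` W); first exact: filterI.
  by move=> a [/W'P av /WP as0] u; rewrite inE => /predU1P[->//|/as0].
pose g (y : S) : rng_of_ring E := xget 0 [set a | f a = y].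
have gK : cancel f g.
  by move=> a; apply: f_inj; rewrite /g; case: xgetP => [b -> //|/(_ a)]; case.
exists g; split=> //; apply/subspace_continuousP => _ [a _ <-].
rewrite /from_subspace/=.
have -> : g (f a) = a by exact: gK.
move=> U [Z /finite_seqP[s ->] ZU].
have [W W0 WP] := nbhs_seq s.
case: sigma_ring => addc _ _ _ _.
have Wa : nbhs (f a : Y) [set y : S | W (y - f a)].
  by apply: (nbhs_shift addc); rewrite subrr.
rewrite /fmap/= /within/=; apply: filterS Wa => y Wy [b _ fby].
apply: ZU => v /= vs; rewrite -fby gK.
by apply: (WP (b - a : E)) => //; rewrite raddfB fby.
Qed.

Hypothesis fM : {morph f : x y / rng_mul x y >-> rng_mul x y}.

(** The products rank_one x0 (phi i) o a o rank_one x phi0 are the operators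
    rank_one (c *: x0) phi0 in which c is the i-th coordinate of a x. *)
Lemma nbhs_of_discrete_line (x0 : V) (phi0 : {linear V -> K^o}) n
    (e : 'I_n -> V) (phi : 'I_n -> {linear V -> K^o}) (N : set S) :
  (forall v, v = \sum_i (phi i v : K) *: e i) -> nbhs (0 : Y) N ->
  (forall c : K, N (f (rank_one (c *: x0) phi0)) -> c = 0) ->
  forall x : V, exists2 W : set S, nbhs (0 : Y) W &
     forall a : E, W (f a) -> a x = 0.
Proof.
move=> repr N0 NP x.
exists [set y : S | forall i, N (rng_mul (rng_mul (f (rank_one x0 (phi i))) y)
  (f (rank_one x phi0)))].
  by apply: (@filter_forall Y _ _ _ (nbhs_filter (0 : Y))) => i;
    exact: nbhs0_mulLR.
move=> a Wa; rewrite [RHS](_ : 0 = \sum_i (0 : K) *: e i); last first.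
  by rewrite big1// => i _; rewrite scale0r.
rewrite [LHS]repr; apply: eq_bigr => i _; congr (_ *: _); apply: NP.
have := Wa i; rewrite /= -!fM; congr (N (f _)).
apply: lin_ext => v.
rewrite -[LHS]/(rank_one x0 (phi i) (a (rank_one x phi0 v))).
by rewrite !rank_oneE !linearZ/= scalerA.
Qed.

Hypothesis f_nonzero : ~ (forall a, f a = 0).

(** If f killed one such operator it would kill all rank-one operators, then
    every a o p with p a finite-rank projection, and finally a itself, because
    every neighbourhood of a contains such a product. *)
Lemma image_rank_one_neq0 (x : V) (phi : {linear V -> K^o}) :
  phi x = 1 -> f (rank_one x phi) <> 0.
Proof.
move=> phix fe0; apply: f_nonzero.
have f_rank_one u psi : f (rank_one u psi) = 0.
  have -> : rank_one u psi =
      rng_mul (rng_mul (rank_one u phi : rng_of_ring E) (rank_one x phi))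
        (rank_one x psi).
    apply: lin_ext => v.
    rewrite -[RHS]/(rank_one u phi (rank_one x phi (rank_one x psi v))).
    by rewrite !(rank_oneE, linearZ)/= phix -!scalerA !scale1r.
  by rewrite !fM fe0 rng_mul0 rng_0mul.
move=> a; apply: contrapT => fa0.
have [|U U0 Ufa] := nbhs0_avoiding sigma_ring (y := - f a).
  by move=> Nfa; apply: fa0; rewrite -[f a]opprK Nfa oppr0.
have Ua : nbhs (f a : Y) [set y : S | U (y - f a)].
  case: sigma_ring => addc _ _ _ _.
  by apply: (nbhs_shift addc); rewrite subrr.
have [Z /finite_seqP[s ->] sU] := f_cont Ua.
have [n [e [psi [_ repr]]]] := coordinate_system K_division s.
pose p : rng_of_ring E := \sum_i rank_one (e i) (psi i).
have pE v : (p : E) v = \sum_i (psi i v : K) *: e i.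
  by rewrite /p; elim/big_ind2 : _ => [//|g u h w <- <- //|//].
have fp : f p = 0 by rewrite raddf_sum big1.
have fap : f (rng_mul a p) = 0 by rewrite fM fp rng_mul0.
apply: Ufa; rewrite -[- f a]add0r -fap.
apply: (sU (rng_mul a p)) => v vs.
rewrite -[LHS]/((a : E) ((p : E) v) - (a : E) v) pE -(repr _ vs).
exact: subrr.
Qed.

Lemma nbhs_of_infinite_dimensional :
  ~ finite_dimensional V ->
  forall x : V, exists2 W : set S, nbhs (0 : Y) W &
     forall a : E, W (f a) -> a x = 0.
Proof.
move=> infV x.
have [->|x0] := eqVneq x 0.
  by exists setT => [|a _]; [exact: filterT|exact: linear0].
have [phi0 phix] := normalizing_functional K_division x0.
pose e0 := rank_one x phi0.
have [U U0 Ue] := nbhs0_avoiding sigma_ring (image_rank_one_neq0 phix).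
have [W W0 WU] := nbhs0_mul sigma_ring U0.
have := f_cont (x := 0); rewrite /continuous_at raddf0 => /(_ W W0).
move=> [Z /finite_seqP[s ->] sW].
have [n [e [phi [dual repr]]]] := coordinate_system K_division s.
pose M := [set v | v = \sum_i (phi i v : K) *: e i].
have Ms : subspace_of M by exact: subspace_reconstructed.
have [w Mw] : exists w, ~ M w.
  apply: contrapT => noW; apply: infV; exists n, e; split; last first.
    move=> v; exists (fun i => phi i v); apply: contrapT => Mv.
    by apply: noW; exists v.
  move=> c c0 i; have := congr1 (phi i) c0.
  rewrite linear0 linear_sum (bigD1 i)//= linearZ/= dual eqxx big1 => [|j ji].
    by rewrite addr0 /GRing.scale/= mulr1.
  by rewrite linearZ/= dual eq_sym (negPf ji) scaler0.
(* The identity tests whether a x lies in M; as w does not, the i-th rank-one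
   multiplier sends a x into M only if the i-th coordinate of a x vanishes. *)
exists ([set y : S | W (rng_mul (rng_mul (f (lin_one V)) y) (f e0))] `&`
  [set y : S |
    forall i, W (rng_mul (rng_mul (f (rank_one w (phi i))) y) (f e0))]).
  apply: filterI; first exact: nbhs0_mulLR.
  by apply: (@filter_forall Y _ _ _ (nbhs_filter (0 : Y))) => i;
    exact: nbhs0_mulLR.
move=> a [/= Wa Wia].
have WP (t : E) :
    W (f (rng_mul (rng_mul (t : rng_of_ring E) a) e0)) -> M (t (a x)).
  move=> Wt; apply: contrapT => Mt.
  have [psi [psiM psit]] := separating_functional K_division Ms Mt.
  apply: Ue.
  rewrite (_ : rank_one x phi0 = rng_mul (rank_one x psi : rng_of_ring E)
    (rng_mul (rng_mul (t : rng_of_ring E) a) e0)).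
    rewrite fM; apply: WU => //; apply: sW => v vs.
    rewrite -[LHS]/((psi v : K) *: x - 0) subr0 psiM ?scale0r//; exact: repr.
  apply: lin_ext => v.
  rewrite -[RHS]/(rank_one x psi (t (a (rank_one x phi0 v)))).
  by rewrite !rank_oneE !linearZ/= psit /GRing.scale/= mulr1.
have Max : M (a x) by apply: (WP (lin_one V)); rewrite !fM.
rewrite [a x]Max big1// => i _.
have [->|ci] := eqVneq (phi i (a x) : K) 0; first by rewrite scale0r.
have : M (rank_one w (phi i) (a x)) by apply: WP; rewrite !fM.
rewrite rank_oneE => /(subspace_ofZ (phi i (a x))^-1 Ms).
by rewrite scalerA mulVr ?K_division// scale1r.
Qed.

End Homomorphism.

(** * Ring topologies on the division ring *)

Section RightVectorSpace.
Variables (F : unitRingType).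
Hypothesis F_division : forall x : F, x != 0 -> x \is a GRing.unit.
Variable A : lmodType F^c.
Local Notation E := {linear A -> A}.
Local Notation S := (rng_of_ring E).
Local Notation X := (Topological.Pack (finite_topology A)).
Local Notation functional := {linear A -> F^c^o}.

Fact converse_division : forall x : F^c, x != 0 -> x \is a GRing.unit.
Proof. exact: F_division. Qed.

(** The product is that of F, not of its converse: composition of operators
    reverses the order of the scalars, which act on the right. *)
Lemma line_to_rank_one_mul (x0 : A) (phi0 : functional) (a b : F) :
  phi0 x0 = 1 ->
  rank_one (((a * b : F) : F^c) *: x0) phi0 =
  rng_mul (rank_one ((a : F^c) *: x0) phi0 : S)
    (rank_one ((b : F^c) *: x0) phi0).
Proof.
move=> phix; apply: lin_ext => v.
rewrite -[RHS]/(rank_one _ phi0 (rank_one _ phi0 v)).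
rewrite !rank_oneE !linearZ/= phix !scalerA; congr (_ *: _).
by rewrite /GRing.scale/= mulr1 -mulrA.
Qed.

Section PullBack.
Variables (S' : rng) (sigma : Topological S').
Local Notation Y := (Topological.Pack sigma).
Hypothesis sigma_ring : ring_topology sigma.
Variable f : {additive S -> S'}.
Hypothesis f_cont : continuous (f : X -> Y).
Hypothesis fM : {morph f : x y / rng_mul x y >-> rng_mul x y}.
Hypothesis f_nonzero : ~ (forall a, f a = 0).

Lemma discrete_line (x0 : A) (phi0 : functional) :
  ~ (exists tau : Topological F,
      @ring_topology (rng_of_ring F) tau /\
      ~ discrete (Topological.Pack tau)) ->
  phi0 x0 = 1 ->
  exists2 N : set S', nbhs (0 : Y) N &
    forall c : F^c, N (f (rank_one (c *: x0) phi0)) -> c = 0.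
Proof.
move=> no_tau phix.
pose h (a : rng_of_ring F) := f (rank_one ((a : F^c) *: x0) phi0) : S'.
have hD : {morph h : x y / x + y}.
  by move=> a b; rewrite /h -raddfD -rank_oneDl -scalerDl.
have hM : {morph h : x y / rng_mul x y >-> rng_mul x y}.
  by move=> a b; rewrite /h -fM -line_to_rank_one_mul.
have h0 : h 0 = 0 by apply: (addrI (h 0)); rewrite -hD !addr0.
have h_inj a : h a = 0 -> a = 0.
  move=> ha; apply/eqP/negP => /negP/F_division a_unit.
  apply: (image_rank_one_neq0 converse_division sigma_ring f_cont fM f_nonzero
    phix).
  rewrite -[x0 in rank_one x0]scale1r -[LHS]/(h 1).
  have -> : (1 : rng_of_ring F) = rng_mul a (a^-1 : F) by rewrite /= mulrV.
  by rewrite hM ha rng_0mul.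
pose tau := @initial_of_family (rng_of_ring F) S' sigma unit (fun=> h).
have tau_ring : @ring_topology (rng_of_ring F) tau.
  apply: (@initial_ring_topology (rng_of_ring F)) => //.
    move=> a b /(_ tt) hab; apply/eqP; rewrite -subr_eq0; apply/eqP/h_inj.
    by apply: (addIr (h b)); rewrite -hD subrK add0r.
  move=> _; pose Z := Topological.Pack tau.
  rewrite (_ : (fun p => _) =
      fun p : Z * Z => rng_mul (h p.1) (h p.2) : Y).
    case: sigma_ring => _ _ mulc _ _.
    have hc : continuous (h : Z -> Y).
      exact: (@continuous_of_initial (rng_of_ring F) S' sigma _ (fun=> h) tt).
    exact: (@continuous_op2_pair Z Z Y Y Y
      (fun p : Y * Y => rng_mul (p.1 : S') (p.2 : S') : Y) h h).
  by apply/funext => p; rewrite hM.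
have [|N N0 hN] := @nbhs_initial_constant _ S' sigma unit (fun=> h) h
  (fun=> erefl) 0 [set 0].
  apply: open_nbhs_nbhs; split => //; apply: contrapT => nopen.
  by apply: no_tau; exists tau; split => // d; apply: nopen; exact: d.
by rewrite h0 in N0; exists N => // c; exact: hN.
Qed.

End PullBack.

Section WeakOperatorTopology.
Variable tau : Topological F.
Local Notation Z := (Topological.Pack tau).
Hypothesis tau_ring : @ring_topology (rng_of_ring F) tau.

Definition matrix_entry (i : functional * A) (a : S) : rng_of_ring F :=
  i.1 ((a : E) i.2) : F.

Definition weak_operator_topology : Topological E :=
  @initial_of_family S (rng_of_ring F) tau _ matrix_entry.
Local Notation W := (Topological.Pack weak_operator_topology).

Lemma matrix_entry_continuous i : continuous (matrix_entry i : W -> Z).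
Proof. exact: (@continuous_of_initial S (rng_of_ring F) tau). Qed.

(** Inserting the identity as a sum of rank-one operators between two
    operators writes each entry of their product as a finite sum of products
    of entries; this is where finite dimension is used. *)
Lemma weak_operator_ring_topology : finite_dimensional A ->
  @ring_topology S weak_operator_topology.
Proof.
move=> /(basis_coordinates converse_division)[n [e [phi repr]]].
have [addc _ mulc _ _] := tau_ring.
apply: initial_ring_topology => //.
- move=> i a b; rewrite /matrix_entry.
  by rewrite -[(a + b : E) _]/((a : E) i.2 + (b : E) i.2) linearD.
- move=> a b ab; apply: lin_ext => v; rewrite [LHS]repr [RHS]repr.
  by apply: eq_bigr => i _; congr (_ *: _); exact: (ab (phi i, v)).
- move=> [psi v].
  rewrite (_ : (fun p => _) = fun p : W * W => \sum_k
    (matrix_entry (psi, e k) p.1 * matrix_entry (phi k, v) p.2 : F) : Z).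
    apply: (@continuous_big_add F tau (W * W)%type n _ addc) => k.
    apply: (@continuous_op2_pair W W Z Z Z
      (fun p : Z * Z => (p.1 : F) * (p.2 : F) : Z)
      (matrix_entry (psi, e k)) (matrix_entry (phi k, v))) => //;
      exact: matrix_entry_continuous.
  apply/funext => p; rewrite -[LHS]/(psi ((p.1 : E) ((p.2 : E) v)) : F).
  rewrite [(p.2 : E) v]repr !linear_sum; apply: eq_bigr => k _.
  by rewrite !linearZ/=.
Qed.

Lemma line_continuous (x0 : A) (phi0 : functional) :
  continuous (fun a : Z => rank_one (((a : F) : F^c) *: x0) phi0 : W).
Proof.
have [_ _ mulc _ _] := tau_ring.
apply: (@continuous_to_initial S (rng_of_ring F) tau _ matrix_entry Z).
move=> [psi v].
rewrite (_ : _ \o _ =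
    fun a : Z => (psi x0 : F) * ((a : F) * (phi0 v : F)) : Z).
  apply: (@continuous_op2 _ Z Z Z (fun p : Z * Z => (p.1 : F) * (p.2 : F) : Z)
    (fun _ : Z => (psi x0 : F) : Z)
    (fun a : Z => (a : F) * (phi0 v : F) : Z)) => //.
    by move=> a; apply: cvg_cst.
  apply: (@continuous_op2 _ Z Z Z (fun p : Z * Z => (p.1 : F) * (p.2 : F) : Z)
    id (fun _ : Z => (phi0 v : F) : Z)) => //; first by move=> a; apply: cvg_id.
  by move=> a; apply: cvg_cst.
apply/funext => a.
rewrite -[LHS]/(psi ((phi0 v : F^c) *: ((a : F^c) *: x0)) : F).
by rewrite !linearZ /GRing.scale/= /GRing.scale/= mulrA.
Qed.

Lemma discrete_of_completely_simple (x0 : A) (phi0 : functional) :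
  phi0 x0 = 1 -> finite_dimensional A ->
  @completely_simple S (finite_topology A) -> discrete Z.
Proof.
move=> phix Afin [_ _ simple].
have [addc _ _ _ _] := tau_ring.
have fin0 (U : set E) (a : E) : U a -> nbhs (a : X) U.
  move=> Ua; apply: open_nbhs_nbhs; split=> //.
  exact: (finite_topology_discrete Afin).
have [|id0|[_ [g [gK gc]]]] := simple S weak_operator_topology
    (weak_operator_ring_topology Afin) idfun (fun _ _ => erefl).
- by move=> a U aU; apply: fin0; exact: (nbhs_singleton aU).
- have x00 : x0 = 0 := congr1 (fun f : E => f x0) (id0 (lin_one A)).
  by have /eqP := phix; rewrite x00 linear0 eq_sym oner_eq0.
have gid : g = id by apply/funext => a; exact: gK.
have nbhs0 : nbhs (0 : W) [set 0].
  have : range (idfun : E -> E) 0 by exists 0.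
  have [+ _] := @subspace_continuousP W (range idfun) X g.
  move=> /(_ gc 0) /[apply] /(_ [set 0]).
  rewrite gid => /(_ (fin0 _ _ erefl)); rewrite /within/= => nbhs_range.
  apply: (@filterS W _ (nbhs_filter _) _ _ _ nbhs_range).
  by move=> b; apply; exists b.
apply: (discrete_of_nbhs0 addc).
have := @line_continuous x0 phi0 (0 : F).
rewrite /continuous_at (_ : rank_one _ _ = 0); last first.
  by apply: lin_ext => v; rewrite rank_oneE scale0r scaler0.
move=> /(_ _ nbhs0) line0.
apply: (@filterS Z _ (nbhs_filter _) _ _ _ line0) => a.
move=> /(congr1 (fun f : E => phi0 (f x0))).
rewrite /= phix scale1r linearZ phix linear0.
exact: etrans (esym (mul1r (a : F))).
Qed.

End WeakOperatorTopology.

End RightVectorSpace.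

(* A right vector space over F is a left module over the converse ring F^c:
   the scalar multiplication v.a is written (a : F^c) *: v. *)
Theorem theorem6 (F : unitRingType)
    (F_division : forall x : F, x != 0 -> x \is a GRing.unit)
    (A : lmodType F^c) (A_nonzero : exists v : A, v != 0) :
  @completely_simple (rng_of_ring {linear A -> A}) (finite_topology A) <->
  (~ finite_dimensional A \/
   (finite_dimensional A /\
    ~ exists tau : Topological F,
        @ring_topology (rng_of_ring F) tau /\ ~ discrete (Topological.Pack tau))).
Proof.
have [x0 x0_neq0] := A_nonzero.
have [phi0 phix] := normalizing_functional (converse_division F_division) x0_neq0.
split=> [simple|dimA].
  have [Afin|Ainf] := pselect (finite_dimensional A); [right|by left].
  split=> // -[tau [tau_ring tau_nondiscrete]]; apply: tau_nondiscrete.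
  exact: (discrete_of_completely_simple F_division tau_ring phix Afin simple).
split.
- exact: finite_ring_topology.
- move/(_ (lin_one A) (lin_one A)).
  move=> /(congr1 (fun f : {linear A -> A} => f x0)); exact/eqP.
move=> S' sigma sigma_ring f fM fc.
have [|f_nonzero] := pselect (forall x, f x = 0); [by left|right].
apply: homeomorphism_of_nbhs => //.
case: dimA => [Ainf|[Afin no_tau]].
  exact: nbhs_of_infinite_dimensional.
have [n [e [phi repr]]] := basis_coordinates (converse_division F_division) Afin.
have [N N0 NP] :=
  discrete_line F_division sigma_ring fc fM f_nonzero no_tau phix.
exact: (nbhs_of_discrete_line sigma_ring fM repr N0 NP).
Qed.
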